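(* Let $M_{t,s}(x,y)=\int_s^tG_{t-u}(x,y)\,\partial_uK_H(u,s)\,du$ for $0<s<t\le T$ and $x,y\in[0,1]$. Then there exist strictly positive constants $c_5,c_6,c_7,c_8$ such that, for all such $s,t,x,y$, $$M_{t,s}(x,y)\le c_5(t-s)^{-(1-H)}\Big(\frac ts\Big)^{H-1/2}\Big[\exp\Big(-\frac{c_6(x-y)^2}{t-s}\Big)+\exp\Big(-\frac{c_6(x+y-2)^2}{t-s}\Big)\Big]$$ and $$|\partial_tM_{t,s}(x,y)|\le c_7(t-s)^{-(2-H)}\Big(\frac ts\Big)^{H-1/2}\Big[\exp\Big(-\frac{c_8(x-y)^2}{t-s}\Big)+\exp\Big(-\frac{c_8(x+y-2)^2}{t-s}\Big)\Big].$$
   Context: Fix $T>0$ and $H\in(\frac12,1)$. For $0<s\le t$, $K_H(t,s)=C_Hs^{\frac12-H}\int_s^t(u-s)^{H-\frac32}u^{H-\frac12}\,du$, where $C_H>0$ is the constant (depending only on $H$) for which $\int_0^{s\wedge t}K_H(t,u)K_H(s,u)\,du=H(2H-1)\int_0^t\int_0^s|u-r|^{2H-2}\,du\,dr$. $G_t(x,y)=\frac{1}{\sqrt{4\pi t}}\sum_{n=-\infty}^{\infty}\big[e^{-(y-x-2n)^2/(4t)}-e^{-(y+x-2n)^2/(4t)}\big]$ is the Dirichlet heat kernel on $[0,1]$. *)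

(* Defs.v *)
From HB Require Import structures.
From mathcomp Require Import all_boot all_order all_algebra.
From mathcomp Require Import all_classical all_reals all_analysis.

Set Implicit Arguments.
Unset Strict Implicit.
Unset Printing Implicit Defensive.

Import Order.TTheory GRing.Theory Num.Theory.
Import numFieldNormedType.Exports.

Local Open Scope classical_set_scope.
Local Open Scope ring_scope.

Section Kernels.
Context {R : realType}.
Local Notation mu := (@lebesgue_measure R).
Implicit Types (H C s t u x y : R).

(* The Volterra kernel with an arbitrary normalising constant C; the right one
   is singled out by [is_KH_const].  Only used for 0 < s; for t <= s the
   integral is over the empty set and the value is 0. *)
Definition KH H C t s : R :=
  C * s `^ (2^-1 - H) *
  \int[mu]_(u in `]s, t[) ((u - s) `^ (H - 3 / 2) * u `^ (H - 2^-1)).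

Definition is_KH_const H C : Prop :=
  0 < C /\
  forall s t, 0 < s -> 0 < t ->
    \int[mu]_(u in `]0, Num.min s t[) (KH H C t u * KH H C s u) =
    H * (2 * H - 1) *
    \int[mu]_(r in `]0, t[) \int[mu]_(u in `]0, s[) (`|u - r| `^ (2 * H - 2)).

(* Bilateral series, as the sum of its two one-sided halves. *)
Definition sum_int (f : int -> R) : R :=
  limn (series (fun n : nat => f n%:Z)) +
  limn (series (fun n : nat => f (- n.+1%:Z))).

Definition dirichlet_kernel t x y : R :=
  (Num.sqrt (4 * pi * t))^-1 *
  sum_int (fun n : int =>
    expR (- ((y - x - 2 * n%:~R) ^+ 2 / (4 * t))) -
    expR (- ((y + x - 2 * n%:~R) ^+ 2 / (4 * t)))).

Definition M_integrand H C t s x y u : R :=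
  dirichlet_kernel (t - u) x y * derive1 (fun v : R => KH H C v s) u.

Definition M_kernel H C t s x y : R :=
  \int[mu]_(u in `]s, t[) M_integrand H C t s x y u.

End Kernels.

(* Main.v *)
(** The derivative of [K_H] in its first argument is
    [C_H (u/s)^a (u-s)^(a-1)] with [a = H - 1/2], so the substitution
    [u = s + (t-s) th] turns [M_{t,s}(x,y)] into an integral over the fixed
    interval [0 < th < 1] whose integrand depends smoothly on [t]: the singular
    weight [th^(a-1)] no longer moves with [t].  All image points in the Dirichlet
    series lie at distance at least [|x-y|] and move away linearly, hence for
    [v] in a bounded range the kernel is [O(v^(-1/2) e)] and its time derivative is
    [O(v^(-3/2) e)] with [e = exp(-(x-y)^2/(16 v))].  After the substitution
    [v = (t-s)(1-th)], both the integrand and its [t]-derivative are dominated by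
    the integrable weight [th^(a-1) (1-th)^(-1/2)] times the claimed bound, and one
    differentiates under the integral sign.  The first of the two exponentials
    already suffices. *)

Require Import Defs.
From HB Require Import structures.
From mathcomp Require Import all_boot all_order all_algebra.
From mathcomp Require Import all_classical all_reals all_analysis measurable_realfun.
From mathcomp Require Import ring lra.

Set Implicit Arguments.
Unset Strict Implicit.
Unset Printing Implicit Defensive.

Import Order.TTheory GRing.Theory Num.Theory.
Import numFieldNormedType.Exports.

Local Open Scope classical_set_scope.
Local Open Scope ring_scope.

(** * Affine substitution in Lebesgue integrals *)

Section affine_substitution.
Context {R : realType}.
Notation mu := (@lebesgue_measure R).
Variables (c k : R).
Hypothesis k0 : 0 < k.
Let phi (x : R) : R := c + k * x.

Let mphi : @measurable_fun _ _ (measurableTypeR R) (measurableTypeR R) setT phi.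
Proof. exact: measurable_funD. Qed.

Lemma preimage_affine_itv (b1 b2 : bool) (p q : R) :
  (phi : R -> R) @^-1` [set` Interval (BSide b1 p) (BSide b2 q)] =
  [set` Interval (BSide b1 ((p - c) / k)) (BSide b2 ((q - c) / k))].
Proof.
apply/seteqP; split => x /=; rewrite /phi; case: b1 b2 => [] []; rewrite !in_itv /=.
all: rewrite ?ler_pdivrMr ?ltr_pdivrMr ?ler_pdivlMr ?ltr_pdivlMr// => /andP[h1 h2].
all: by apply/andP; split; lra.
Qed.

(** Lebesgue measure is the image under [phi] of [k] times itself: the two agree on bounded
    half-open intervals, hence everywhere by uniqueness. The formula is then the pushforward
    formula. *)
Lemma ge0_integral_affine (D : set R) (f : R -> \bar R) :
  measurable D -> measurable_fun D f -> (forall x, D x -> (0 <= f x)%E) ->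
  (\int[mu]_(x in D) f x = k%:E * \int[mu]_(x in phi @^-1` D) f (phi x))%E.
Proof.
move=> mD mf f0.
have k0' : 0 <= k by exact: ltW.
have mpD : measurable (phi @^-1` D) by rewrite -[X in measurable X]setTI; exact: mphi.
rewrite -(ge0_integral_mscale mu mpD (NngNum k0'))//; last 2 first.
- by apply: measurable_comp mf _ => //; [move=> _ [x Dx <-]|exact: measurable_funTS].
- by move=> x Dx; exact: f0.
have f0' : {in D, forall y, (0 <= f y)%E} by move=> x /set_mem; exact: f0.
have /= <- := ge0_integral_pushforward mphi (mscale (NngNum k0') mu) mD mf f0'.
apply: eq_measure_integral => //= A mA _.
apply: lebesgue_measure_unique => //= _ [[p q] _ <-].
rewrite /pushforward preimage_affine_itv /mscale /=.
rewrite !lebesgue_measure_itv /= !lte_fin ltr_pM2r ?invr_gt0// ltrD2r.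
case: ifP => _; last by rewrite mule0.
by rewrite -!EFinB -EFinM; congr EFin; field; rewrite gt_eqF.
Qed.

Lemma integrable_affine (D : set R) (f : R -> R) :
  measurable D -> measurable_fun D f ->
  mu.-integrable (phi @^-1` D) (EFin \o (f \o phi)) ->
  mu.-integrable D (EFin \o f).
Proof.
move=> mD mf /integrableP[_ fi]; apply/integrableP; split.
  exact/measurable_EFinP.
rewrite ge0_integral_affine//; first by rewrite lte_mul_pinfty// lee_fin ltW.
by apply: measurableT_comp => //; exact/measurable_EFinP.
Qed.

Lemma Rintegral_affine (D : set R) (f : R -> R) :
  measurable D -> measurable_fun D f ->
  mu.-integrable (phi @^-1` D) (EFin \o (f \o phi)) ->
  \int[mu]_(x in D) f x = k * \int[mu]_(x in phi @^-1` D) f (phi x).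
Proof.
move=> mD mf fi.
have mEf : measurable_fun D (EFin \o f) by exact/measurable_EFinP.
have mpD : measurable (phi @^-1` D) by rewrite -[X in measurable X]setTI; exact: mphi.
rewrite /Rintegral -[k in RHS]/(fine k%:E) -fineM//; last exact: integrable_fin_num.
congr fine; rewrite integralE [in RHS]integralE.
rewrite ge0_integral_affine//; last exact: measurable_funepos.
rewrite [X in (_ - X = _)%E]ge0_integral_affine//; last exact: measurable_funeneg.
rewrite -[(fun x => (f (phi x))%:E)]/((EFin \o f) \o phi).
rewrite (funepos_comp (EFin \o f) phi) (funeneg_comp (EFin \o f) phi).
rewrite [in RHS]muleBr//.
have := integrable_add_def (mpD : @measurable _ (measurableTypeR R) _) fi.
by rewrite (funepos_comp (EFin \o f) phi) (funeneg_comp (EFin \o f) phi).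
Qed.

End affine_substitution.

(** * Integrability of endpoint power singularities *)

Lemma is_derive1_continuous {R : realType} (f : R -> R) (x d : R) :
  is_derive x (1 : R) f d -> {for x, continuous f}.
Proof. by case=> df _; exact/differentiable_continuous/derivable1_diffP. Qed.

Lemma is_derive_powR_affine {R : realType} (c k e x : R) : 0 < c + k * x ->
  is_derive x (1 : R) (fun r => (c + k * r) `^ e)
    (k * (e * (c + k * x) `^ (e - 1))).
Proof.
move=> h; have h1 := @is_derive1_powR _ e _ h.
have h2 : is_derive x (1 : R) (fun r : R => c + k * r) k.
  by apply: is_derive_eq; rewrite add0r mul1r [LHS]mulr1.
rewrite [X in is_derive _ _ _ X]mulrC.
exact: (@is_derive1_comp _ (@powR R ^~ e) (fun r => c + k * r) _ _ _ h1 h2).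
Qed.

(** Exhaust []a, b[] by the compact intervals [[p n, q n]]. On each, the fundamental theorem gives
    the integral as [F (q n) - F (p n)], at most [2 K], and monotone convergence passes this to the
    union. The singularity of [f] at an endpoint is never met. *)
Lemma integrable_bounded_primitive {R : realType} (F f : R -> R) (a b K : R) :
  a < b -> {in `]a, b[, forall x : R, is_derive x (1 : R) F (f x)} ->
  {in `]a, b[, continuous f} -> {in `]a, b[, forall x, 0 <= f x} ->
  {in `]a, b[, forall x, `|F x| <= K} ->
  (@lebesgue_measure R).-integrable `]a, b[ (EFin \o f).
Proof.
move=> ab dF cf f0 FK; set mu := lebesgue_measure.
(* The denominator starts at 3 so that [2 * d n < b - a] already for [n = 0], which makes every
   [[p n, q n]] nondegenerate. *)
pose d n : R := (b - a) / n.+3%:R.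
pose p n : R := a + d n.
pose q n : R := b - d n.
have ba0 : 0 < b - a by rewrite subr_gt0.
have d0 n : 0 < d n by rewrite divr_gt0.
have dlt n : d n + d n < b - a.
  rewrite /d -mulrDl ltr_pdivrMr// -mulr2n -[X in X < _]mulr_natr ltr_pM2l// ltr_nat.
  by [].
have pq n : p n < q n by rewrite /p /q; move: (d n) (dlt n) => u; lra.
have sub n : `[p n, q n]%classic `<=` `]a, b[.
  move=> x /=; rewrite !in_itv/= /p /q => /andP[h1 h2].
  by move: (d n) (d0 n) h1 h2 => u u0 h1 h2; apply/andP; split; lra.
have nd : nondecreasing_seq (fun n => `[p n, q n]%classic).
  apply/nondecreasing_seqP => n; apply/subsetPset => x /=.
  rewrite !in_itv/= /p /q => /andP[h1 h2].
  have : d n.+1 <= d n.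
    by rewrite /d ler_pM2l// lef_pV2 ?posrE ?ltr0n// ler_nat.
  by move: (d n.+1) (d n) h1 h2 => u v h1 h2 h; apply/andP; split; lra.
have U : `]a, b[%classic = \bigcup_n `[p n, q n]%classic.
  apply/seteqP; split; last by move=> x [n _]; exact: sub.
  move=> x /=; rewrite in_itv/= => /andP[ax xb].
  pose m := Num.min (x - a) (b - x).
  have m0 : 0 < m by rewrite lt_min !subr_gt0 ax.
  have [n _ hn] : \forall n \near \oo, (b - a) / m < n%:R by exact: nbhs_infty_gtr.
  exists n => //=; rewrite in_itv/= /p /q.
  have : d n <= m.
    rewrite /d ler_pdivrMr ?ltr0n// mulrC -ler_pdivrMr//.
    apply: ltW; apply: lt_le_trans (hn n (leqnn _)) _.
    by rewrite ler_nat; do 3 apply: leqW.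
  by rewrite le_min; move: (d n) => u /andP[h1 h2]; apply/andP; split; lra.
have mf : measurable_fun `]a, b[ f.
  by apply: open_continuous_measurable_fun => //; exact/in_continuous_mksetP.
apply/integrableP; split; first exact/measurable_EFinP.
have -> : (\int[mu]_(x in `]a, b[) `|(EFin \o f) x| = \int[mu]_(x in `]a, b[) (f x)%:E)%E.
  by apply: eq_integral => x /[!inE] xab /=; rewrite ger0_norm// f0.
apply: (@le_lt_trans _ _ (K + K)%:E); last exact: ltry.
rewrite U.
have cv := @ge0_nondecreasing_set_cvg_integral _ _ _
  (fun n => `[p n, q n]%classic : set (measurableTypeR R)) (EFin \o f) mu nd.
have mfi i : measurable_fun `[p i, q i] (EFin \o f).
  by apply/measurable_EFinP; exact: (@measurable_funS _ _ _ _ `]a, b[%classic _ f).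
have f0i i x : `[p i, q i]%classic x -> (0 <= (EFin \o f) x)%E.
  by move=> /sub /= xab; rewrite lee_fin f0.
have {}cv := cv (fun=> measurable_itv _) mfi f0i.
rewrite -(cvg_lim _ cv)//; apply: lime_le; first exact: cvgP cv.
apply: nearW => n.
have inab x : x \in `[p n, q n] -> x \in `]a, b[ by move=> h; exact: (sub n).
have dFx x : x \in `[p n, q n] -> derivable F x 1.
  by move=> /inab h; have [] := dF x h.
have cF : {within `[p n, q n], continuous F}.
  by apply: derivable_within_continuous => x xpq; exact: dFx.
rewrite (@continuous_FTC2 _ f F)//.
- rewrite -EFinB lee_fin.
  have hp : `|F (p n)| <= K by apply/FK/inab; rewrite in_itv/= lexx ltW.
  have hq : `|F (q n)| <= K by apply/FK/inab; rewrite in_itv/= lexx ltW.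
  by move: hp hq; rewrite !ler_norml => /andP[h1 h2] /andP[h3 h4]; lra.
- apply: continuous_in_subspaceT => x; rewrite inE => /inab; exact: cf.
- have /(continuous_within_itvP _ (pq n)) [_ c1 c2] := cF.
  by split => // x xpq; apply: dFx; exact: subset_itv_oo_cc.
- move=> x xpq; rewrite derive1E; have := dF x (inab _ (subset_itv_oo_cc xpq)).
  by move=> h; exact: derive_val.
Qed.

Lemma integrable_powR_left {R : realType} (a b e : R) : a < b -> 0 < e ->
  (@lebesgue_measure R).-integrable `]a, b[ (EFin \o (fun x => (x - a) `^ (e - 1))).
Proof.
move=> ab e0.
have dF d x : 0 < x - a ->
    is_derive x (1 : R) (fun r => (r - a) `^ d) (d * (x - a) `^ (d - 1)).
  move=> xa; have := @is_derive_powR_affine _ (- a) 1 d x.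
  by under eq_fun do rewrite mul1r addrC; rewrite !mul1r addrC; exact.
apply: (@integrable_bounded_primitive _ (fun x => e^-1 * (x - a) `^ e) _ _ _
  (e^-1 * (b - a) `^ e)) => // x; rewrite in_itv/= => /andP[ax xb].
- have := dF e x; rewrite subr_gt0 => /(_ ax) h.
  by apply: is_derive_eq; rewrite [LHS]mulKf// gt_eqF.
- by apply: is_derive1_continuous; apply: dF; rewrite subr_gt0.
- exact: powR_ge0.
- rewrite ger0_norm; last by rewrite mulr_ge0 ?invr_ge0 ?powR_ge0 ?ltW.
  by rewrite ler_pM2l ?invr_gt0// ge0_ler_powR ?nnegrE; lra.
Qed.

Lemma integrable_powR_right {R : realType} (a b e : R) : a < b -> 0 < e ->
  (@lebesgue_measure R).-integrable `]a, b[ (EFin \o (fun x => (b - x) `^ (e - 1))).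
Proof.
move=> ab e0.
have dF d x : 0 < b - x ->
    is_derive x (1 : R) (fun r => (b - r) `^ d) (- (d * (b - x) `^ (d - 1))).
  move=> xa; have := @is_derive_powR_affine _ b (- 1) d x.
  by under eq_fun do rewrite mulN1r; rewrite !mulN1r; exact.
apply: (@integrable_bounded_primitive _ (fun x => (- e^-1) * (b - x) `^ e) _ _ _
  (e^-1 * (b - a) `^ e)) => // x; rewrite in_itv/= => /andP[ax xb].
- have := dF e x; rewrite subr_gt0 => /(_ xb) h.
  by apply: is_derive_eq; rewrite [LHS]mulrNN mulKf// gt_eqF.
- by apply: is_derive1_continuous; apply: dF; rewrite subr_gt0.
- exact: powR_ge0.
- rewrite mulNr normrN ger0_norm; last by rewrite mulr_ge0 ?invr_ge0 ?powR_ge0 ?ltW.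
  by rewrite ler_pM2l ?invr_gt0// ge0_ler_powR ?nnegrE; lra.
Qed.

(** * Gaussian series *)

(** This rewrites a limit of partial sums as an integral against counting measure, so that
    differentiation under the integral sign also serves for series. *)
Lemma limn_series_counting {R : realType} (f : nat -> R) :
  (forall n, 0 <= f n) -> (@counting nat R).-integrable setT (EFin \o f) ->
  cvgn (series f) /\ limn (series f) = \int[counting]_n f n.
Proof.
move=> f0 fi.
have f0' i : xpredT i -> (0 <= (EFin \o f) i)%E by rewrite /= lee_fin.
have sT : [set x | xpredT x] = [set: nat] by exact: set_true.
have sf : summable [set x | xpredT x] (EFin \o f).
  move/integrableP : fi => [_]; rewrite ge0_integral_count// => h.
  by rewrite /summable sT -nneseries_esumT.
split; first exact: (summable_cvg f0' sf).
rewrite /Rintegral integral_count; last by rewrite -sT.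
by rewrite (summable_nneseries_lim f0' sf).
Qed.

Lemma integrable_counting_geometric {R : realType} (a q : R) :
  0 <= a -> 0 <= q < 1 ->
  (@counting nat R).-integrable setT (EFin \o geometric a q).
Proof.
move=> a0 /andP[q0 q1]; apply/integrableP; split => //.
rewrite ge0_integral_count//.
have cg : series (geometric a q) @ \oo --> a * (1 - q)^-1.
  by apply: cvg_geometric_series; rewrite ger0_norm.
suff -> : (\sum_(k <oo) `|(EFin \o geometric a q) k| = (a * (1 - q)^-1)%:E)%E.
  exact: ltry.
apply/cvg_lim => //.
rewrite (_ : (fun n => _) = EFin \o series (geometric a q)); last first.
  apply/funext => n /=; rewrite /series /= -sumEFin.
  by apply: eq_bigr => i _ /=; rewrite ger0_norm// mulr_ge0// exprn_ge0.
by apply: cvg_EFin; [exact: nearW|exact: cg].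
Qed.

Lemma is_derive_expR_Ndiv {R : realType} (m v : R) : 0 < v ->
  is_derive v (1 : R) (fun r => expR (- (m / (4 * r))))
    (m / (4 * v) / v * expR (- (m / (4 * v)))).
Proof.
move=> v0.
have h : is_derive v (1 : R) (fun r : R => - (m / 4) * r^-1) (m / (4 * v) / v).
  have := @is_deriveV _ id v 1 1 _ (@is_derive_id _ _ _ _).
  move=> /(_ (lt0r_neq0 v0)) h.
  apply: is_derive_eq; rewrite /GRing.scale /=; field.
  by rewrite gt_eqF.
have E : (fun r => expR (- (m / (4 * r)))) = (fun r : R => expR (- (m / 4) * r^-1)).
  by apply/funext => r; rewrite invfM mulrA mulNr.
rewrite mulrC E (_ : - (m / (4 * v)) = - (m / 4) * v^-1).
exact: (@is_derive1_comp _ expR (fun r : R => - (m / 4) * r^-1) _ _ _ _ h).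
by rewrite invfM mulrA mulNr.
Qed.

(* With [w = m / (4 v)] this is [w e^(-w) <= 2 e^(-w/2)]. *)
Lemma expR_Ndiv_derive_le {R : realType} (m v : R) : 0 <= m -> 0 < v ->
  m / (4 * v) / v * expR (- (m / (4 * v))) <= 2 / v * expR (- (m / (8 * v))).
Proof.
move=> m0 v0; set w := m / (4 * v).
have w0 : 0 <= w by rewrite /w divr_ge0// mulr_ge0// ltW.
have -> : m / (8 * v) = w / 2 by rewrite /w; field; rewrite gt_eqF.
have E : expR (- w) = expR (- (w / 2)) * expR (- (w / 2)).
  by rewrite -expRD; congr expR; field.
have h : w / 2 * expR (- (w / 2)) <= 1.
  rewrite -[leRHS](expRxMexpNx_1 (w / 2)) ler_wpM2r ?expR_ge0//.
  by have := expR_ge1Dx (w / 2); lra.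
rewrite E.
have -> : w / v * (expR (- (w / 2)) * expR (- (w / 2))) =
  2 / v * expR (- (w / 2)) * (w / 2 * expR (- (w / 2))).
  by field; rewrite gt_eqF.
by rewrite ler_piMr// mulr_ge0 ?expR_ge0// divr_ge0// ltW.
Qed.

(** * One-sided Gaussian series and their derivative in time *)

Section theta_series.
Context {R : realType}.
Implicit Types (z : nat -> R) (d T v : R).

(** The sequence [exp (- (n - 1) / (16 T))], written as a geometric one: a summable majorant that is
    uniform in [v <= T]. *)
Definition gauss_tail T : R ^nat :=
  geometric (expR ((16 * T)^-1)) (expR (- (16 * T)^-1)).

Definition theta_half z v : R :=
  limn (series (fun n => expR (- (z n ^+ 2 / (4 * v))))).

Lemma gauss_tail_integrable T : 0 < T ->
  (@counting nat R).-integrable setT (EFin \o gauss_tail T).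
Proof.
move=> T0; apply: integrable_counting_geometric; first exact: expR_ge0.
by rewrite expR_ge0 expR_lt1 oppr_lt0 invr_gt0 mulr_gt0.
Qed.

Lemma gauss_tail_ge0 T n : 0 <= gauss_tail T n.
Proof. by rewrite geometric_ge0 ?expR_ge0. Qed.

(* Half of the exponent [z^2 / (8 v)] keeps the decay in [d], the other half,
   through [n - 1 <= z^2], makes the series geometric. *)
Lemma gauss_term_le z d T v n : n%:R - 1 <= z n ^+ 2 -> d ^+ 2 <= z n ^+ 2 ->
  0 < v -> v <= T ->
  expR (- (z n ^+ 2 / (8 * v))) <= expR (- (d ^+ 2 / (16 * v))) * gauss_tail T n.
Proof.
move=> zn zd v0 vT; have T0 : 0 < T by exact: lt_le_trans vT.
rewrite /gauss_tail /= -expRM_natl -!expRD ler_expR.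
have iT0 : 0 < (16 * T)^-1 by rewrite invr_gt0 mulr_gt0.
have iTv : (16 * T)^-1 <= (16 * v)^-1.
  by rewrite lef_pV2 ?posrE ?mulr_gt0// ler_pM2l.
have -> : (8 * v)^-1 = (16 * v)^-1 + (16 * v)^-1 by field; rewrite gt_eqF.
have h1 : (n%:R - 1) * (16 * T)^-1 <= z n ^+ 2 * (16 * T)^-1.
  by rewrite ler_wpM2r// ltW.
have h2 : z n ^+ 2 * (16 * T)^-1 <= z n ^+ 2 * (16 * v)^-1.
  by rewrite ler_wpM2l// sqr_ge0.
have h3 : d ^+ 2 * (16 * v)^-1 <= z n ^+ 2 * (16 * v)^-1.
  by rewrite ler_wpM2r// invr_ge0 mulr_ge0// ltW.
by move: h1 h2 h3; lra.
Qed.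

Section bounds.
Variables (z : nat -> R) (d : R).
(** The first inequality makes the series summable, the second produces the Gaussian decay in [d].
    The shift by 1 leaves room for the image [y + x - 2], of index 1, which vanishes at
    [x = y = 1]. *)
Hypothesis zge : forall n, n%:R - 1 <= z n ^+ 2 /\ d ^+ 2 <= z n ^+ 2.
Let g v n := expR (- (z n ^+ 2 / (4 * v))).
Let dg v n := z n ^+ 2 / (4 * v) / v * g v n.

Let g_ge0 v n : 0 <= g v n. Proof. exact: expR_ge0. Qed.

Let g_le T v n : 0 < v -> v <= T ->
  g v n <= expR (- (d ^+ 2 / (16 * v))) * gauss_tail T n.
Proof.
move=> v0 vT; have h := gauss_term_le (zge n).1 (zge n).2 v0 vT. apply: (le_trans _ h).
rewrite ler_expR lerN2 ler_wpM2l ?sqr_ge0// lef_pV2 ?posrE ?mulr_gt0//.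
by rewrite ler_pM2r//; lra.
Qed.

Let dg_ge0 v n : 0 < v -> 0 <= dg v n.
Proof.
move=> v0; apply: mulr_ge0 => //; apply: divr_ge0; last exact: ltW.
by rewrite divr_ge0 ?sqr_ge0 ?mulr_ge0 ?ltW.
Qed.

Let dg_le T v n : 0 < v -> v <= T ->
  dg v n <= 2 / v * expR (- (d ^+ 2 / (16 * v))) * gauss_tail T n.
Proof.
move=> v0 vT; apply: (le_trans (expR_Ndiv_derive_le (sqr_ge0 _) v0)).
by rewrite -[leRHS]mulrA ler_wpM2l ?divr_ge0 ?(ltW v0)//;
  exact: (gauss_term_le (zge n).1 (zge n).2).
Qed.

Let gint v : 0 < v -> (@counting nat R).-integrable setT (EFin \o g v).
Proof.
move=> v0; apply: le_integrable (gauss_tail_integrable v0) => // n _ /=.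
rewrite lee_fin !ger0_norm ?gauss_tail_ge0//.
apply: le_trans (g_le n v0 (lexx v)) _.
rewrite ler_piMl ?gauss_tail_ge0// expR_le1 oppr_le0.
by rewrite divr_ge0 ?sqr_ge0 ?mulr_ge0// ltW.
Qed.

Let dgint v : 0 < v -> (@counting nat R).-integrable setT (EFin \o dg v).
Proof.
move=> v0; have h := integrableZl measurableT
  (2 / v * expR (- (d ^+ 2 / (16 * v)))) (gauss_tail_integrable v0).
apply: le_integrable h => // n _ /=.
rewrite lee_fin ger0_norm ?dg_ge0//.
by rewrite (le_trans (dg_le n v0 (lexx v)))// ler_norm.
Qed.

Lemma theta_halfE v : 0 < v -> theta_half z v = \int[counting]_n g v n.
Proof. by move=> v0; have [_] := limn_series_counting (g_ge0 v) (gint v0). Qed.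

Lemma theta_half_cvg v : 0 < v ->
  cvgn (series (fun n => expR (- (z n ^+ 2 / (4 * v))))).
Proof. by move=> v0; have [] := limn_series_counting (g_ge0 v) (gint v0). Qed.

(** Termwise differentiation, as differentiation under the counting integral with a majorant valid
    throughout the window []v / 2, 2 * v[]. *)
Lemma theta_half_derive v : 0 < v ->
  is_derive v (1 : R) (theta_half z) (\int[counting]_n dg v n).
Proof.
move=> v0.
have Iv : `]v / 2, 2 * v[%classic v by rewrite /= in_itv/=; apply/andP; split; lra.
have I0 x : `]v / 2, 2 * v[%classic x -> 0 < x.
  by rewrite /= in_itv/= => /andP[h _]; lra.
have dgE (x : R) n : 0 < x -> is_derive x (1 : R) (g ^~ n) (dg x n).
  by move=> x0; exact: is_derive_expR_Ndiv.
have d1 (x : R) n : 0 < x -> derive1 (g ^~ n) x = dg x n.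
  by move=> x0; rewrite derive1E; have [_ ->] := dgE x n x0.
have i x : `]v / 2, 2 * v[%classic x ->
  (@counting nat R).-integrable setT (EFin \o g x) by move=> /I0 /gint.
have di (x : R) n : `]v / 2, 2 * v[%classic x -> setT n -> derivable (g ^~ n) x 1.
  by move=> /I0 x0 _; have [] := dgE x n x0.
(* The majorant: in the window [2 / x <= 4 / v], the tail is taken at the right end [2 * v], and the
   exponential in [d] is bounded by 1. *)
have G0 n : 0 <= 4 / v * gauss_tail (2 * v) n.
  by rewrite mulr_ge0 ?gauss_tail_ge0// divr_ge0// ltW.
have v20 : 0 < 2 * v by rewrite mulr_gt0.
have Gi : (@counting nat R).-integrable setT
    (EFin \o (fun n => 4 / v * gauss_tail (2 * v) n)).
  exact: (integrableZl measurableT (4 / v) (gauss_tail_integrable v20)).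
have Gub (x : R) n : `]v / 2, 2 * v[%classic x -> setT n ->
    `|partial1of2 g x n| <= 4 / v * gauss_tail (2 * v) n.
  move=> xI _; have x0 := I0 _ xI; move: xI; rewrite /= in_itv/= => /andP[xv1 xv2].
  rewrite /partial1of2 d1// ger0_norm ?dg_ge0//.
  apply: (le_trans (dg_le n x0 (ltW xv2))).
  rewrite ler_wpM2r ?gauss_tail_ge0//.
  apply: (@le_trans _ _ (2 / x)).
    rewrite ler_piMr ?divr_ge0 ?(ltW x0)// expR_le1 oppr_le0.
    by rewrite divr_ge0 ?sqr_ge0 ?mulr_ge0 ?ltW.
  by rewrite ler_pdivrMr// mulrAC ler_pdivlMr//; lra.
have nE : {near v, (fun x => \int[counting]_n g x n) =1 theta_half z}.
  near=> x; rewrite theta_halfE//; near: x; exact: lt_nbhsr.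
apply: near_eq_is_derive nE _.
apply: DeriveDef.
  exact: (derivable_under_integral measurableT Iv i di G0 Gi Gub).
rewrite -derive1E (differentiation_under_integral measurableT Iv i di G0 Gi Gub).
by apply: eq_Rintegral => n _; exact: d1.
Unshelve. all: by end_near. Qed.

Lemma theta_half_le T v : 0 < v -> v <= T ->
  `|theta_half z v| <=
    \int[counting]_n gauss_tail T n * expR (- (d ^+ 2 / (16 * v))).
Proof.
move=> v0 vT; have T0 : 0 < T by exact: lt_le_trans vT.
have Ti := gauss_tail_integrable T0.
rewrite theta_halfE// ger0_norm; last by apply: Rintegral_ge0 => n _.
rewrite mulrC -RintegralZl//; apply: le_Rintegral => //; first exact: gint.
  exact: (integrableZl measurableT _ Ti).
by move=> n _; exact: g_le.
Qed.

Lemma theta_half_derive_le T v : 0 < v -> v <= T ->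
  `|derive1 (theta_half z) v| <=
    2 * \int[counting]_n gauss_tail T n / v * expR (- (d ^+ 2 / (16 * v))).
Proof.
move=> v0 vT; have T0 : 0 < T by exact: lt_le_trans vT.
have Ti := gauss_tail_integrable T0.
rewrite derive1E; have [_ ->] := theta_half_derive v0.
rewrite ger0_norm; last by apply: Rintegral_ge0 => n _; exact: dg_ge0.
rewrite [leRHS](_ : _ = 2 / v * expR (- (d ^+ 2 / (16 * v))) *
  \int[counting]_n gauss_tail T n); last by ring.
rewrite -RintegralZl//; apply: le_Rintegral => //; first exact: dgint.
  exact: (integrableZl measurableT _ Ti).
by move=> n _; exact: dg_le.
Qed.

End bounds.

End theta_series.

(** * The Dirichlet heat kernel *)

Section images.
Context {R : realType}.
Implicit Types (x y v T : R) (n : nat).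

(** Since [1 <= w], one has [w <= w ^+ 2], while [|x - y| <= 1 <= w]. This settles all images except
    those of index 0 and 1, which are checked by hand. *)
Let sq_image_ge (w m x y : R) : 0 <= x <= 1 -> 0 <= y <= 1 ->
  1 <= w -> m <= w -> m - 1 <= w ^+ 2 /\ (x - y) ^+ 2 <= w ^+ 2.
Proof. by move=> /andP[? ?] /andP[? ?] w1 wm; rewrite !expr2; split; nra. Qed.

Let natr_cases n : n = 0%N \/ n = 1%N \/ (2 : R) <= n%:R.
Proof. by case: n => [|[|n]]; [left|right;left|right;right; rewrite ler_nat]. Qed.

(** The four families of image displacements follow the two halves of [sum_int]; the left ones start
    at index [-1], so index 0 is counted once. *)
Definition direct_right x y n : R := y - x - 2 * (n%:Z)%:~R.
Definition direct_left x y n : R := y - x - 2 * (- n.+1%:Z)%:~R.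
Definition reflected_right x y n : R := y + x - 2 * (n%:Z)%:~R.
Definition reflected_left x y n : R := y + x - 2 * (- n.+1%:Z)%:~R.

Lemma direct_right_ge x y n : 0 <= x <= 1 -> 0 <= y <= 1 ->
  n%:R - 1 <= direct_right x y n ^+ 2 /\ (x - y) ^+ 2 <= direct_right x y n ^+ 2.
Proof.
move=> hx hy; rewrite /direct_right -pmulrn.
move: (hx) (hy) => /andP[x0 x1] /andP[y0 y1].
have [->|[->|n2]] := natr_cases n.
- by rewrite !expr2; split; nra.
- by rewrite !expr2; split; nra.
- by rewrite -sqrrN; apply: sq_image_ge => //; lra.
Qed.

Lemma direct_left_ge x y n : 0 <= x <= 1 -> 0 <= y <= 1 ->
  n%:R - 1 <= direct_left x y n ^+ 2 /\ (x - y) ^+ 2 <= direct_left x y n ^+ 2.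
Proof.
move=> hx hy; rewrite /direct_left intrN -pmulrn -natr1.
move: (hx) (hy) (ler0n R n) => /andP[x0 x1] /andP[y0 y1] n0.
by apply: sq_image_ge => //; lra.
Qed.

(** The two nearest reflections are no closer than the source because [|x - y| <= x + y] and [|x -
    y| = |(1 - y) - (1 - x)| <= 2 - x - y]. *)
Lemma reflected_right_ge x y n : 0 <= x <= 1 -> 0 <= y <= 1 ->
  n%:R - 1 <= reflected_right x y n ^+ 2 /\
  (x - y) ^+ 2 <= reflected_right x y n ^+ 2.
Proof.
move=> hx hy; rewrite /reflected_right -pmulrn.
move: (hx) (hy) => /andP[x0 x1] /andP[y0 y1].
have [->|[->|n2]] := natr_cases n.
- by rewrite !expr2; split; nra.
- by rewrite !expr2; split; nra.
- by rewrite -sqrrN; apply: sq_image_ge => //; lra.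
Qed.

Lemma reflected_left_ge x y n : 0 <= x <= 1 -> 0 <= y <= 1 ->
  n%:R - 1 <= reflected_left x y n ^+ 2 /\
  (x - y) ^+ 2 <= reflected_left x y n ^+ 2.
Proof.
move=> hx hy; rewrite /reflected_left intrN -pmulrn -natr1.
move: (hx) (hy) (ler0n R n) => /andP[x0 x1] /andP[y0 y1] n0.
by apply: sq_image_ge => //; lra.
Qed.

Definition dirichlet_theta x y v : R :=
  (theta_half (direct_right x y) v - theta_half (reflected_right x y) v) +
  (theta_half (direct_left x y) v - theta_half (reflected_left x y) v).

Lemma limn_seriesB (f g : R ^nat) : cvgn (series f) -> cvgn (series g) ->
  limn (series (fun n => f n - g n)) = limn (series f) - limn (series g).
Proof.
move=> cf cg; rewrite -limB//; congr (limn _); apply/funext => n.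
by rewrite /series /= sumrB.
Qed.

(** Each of the four Gaussian series converges separately, so the series of differences may be
    split. The prefactor becomes a power of [v], ready for the product rule. *)
Lemma dirichlet_kernelE x y v : 0 <= x <= 1 -> 0 <= y <= 1 -> 0 < v ->
  dirichlet_kernel v x y =
  (4 * pi) `^ (- 2^-1) * v `^ (- 2^-1) * dirichlet_theta x y v.
Proof.
move=> hx hy v0; rewrite /dirichlet_kernel; congr (_ * _).
  rewrite -powRM ?mulr_ge0 ?pi_ge0 ?ltW// powRN powR12_sqrt//.
  by rewrite !mulr_ge0 ?pi_ge0 ?ltW.
have cD1 := theta_half_cvg (fun n => direct_right_ge n hx hy) v0.
have cD2 := theta_half_cvg (fun n => direct_left_ge n hx hy) v0.
have cR1 := theta_half_cvg (fun n => reflected_right_ge n hx hy) v0.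
have cR2 := theta_half_cvg (fun n => reflected_left_ge n hx hy) v0.
by rewrite /sum_int /dirichlet_theta -!limn_seriesB.
Qed.
Let four_le (a b c d e : R) : `|a| <= e -> `|b| <= e -> `|c| <= e -> `|d| <= e ->
  `|(a - b) + (c - d)| <= 4 * e.
Proof. by rewrite !ler_norml => /andP[? ?] /andP[? ?] /andP[? ?] /andP[? ?]; lra. Qed.

Lemma dirichlet_theta_le T x y v : 0 <= x <= 1 -> 0 <= y <= 1 -> 0 < v -> v <= T ->
  `|dirichlet_theta x y v| <=
    4 * (\int[counting]_n gauss_tail T n * expR (- ((x - y) ^+ 2 / (16 * v)))).
Proof.
move=> hx hy v0 vT; apply: four_le.
- exact: (theta_half_le (fun n => direct_right_ge n hx hy)).
- exact: (theta_half_le (fun n => reflected_right_ge n hx hy)).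
- exact: (theta_half_le (fun n => direct_left_ge n hx hy)).
- exact: (theta_half_le (fun n => reflected_left_ge n hx hy)).
Qed.

Lemma dirichlet_theta_derive T x y v :
  0 <= x <= 1 -> 0 <= y <= 1 -> 0 < v -> v <= T ->
  exists2 D, is_derive v (1 : R) (dirichlet_theta x y) D &
  `|D| <= 4 * (2 * \int[counting]_n gauss_tail T n / v *
               expR (- ((x - y) ^+ 2 / (16 * v)))).
Proof.
move=> hx hy v0 vT.
have dD1 := theta_half_derive (fun n => direct_right_ge n hx hy) v0.
have dD2 := theta_half_derive (fun n => direct_left_ge n hx hy) v0.
have dR1 := theta_half_derive (fun n => reflected_right_ge n hx hy) v0.
have dR2 := theta_half_derive (fun n => reflected_left_ge n hx hy) v0.
have lD1 := theta_half_derive_le (fun n => direct_right_ge n hx hy) v0 vT.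
have lD2 := theta_half_derive_le (fun n => direct_left_ge n hx hy) v0 vT.
have lR1 := theta_half_derive_le (fun n => reflected_right_ge n hx hy) v0 vT.
have lR2 := theta_half_derive_le (fun n => reflected_left_ge n hx hy) v0 vT.
eexists.
  exact: (is_deriveD (is_deriveB dD1 dR1) (is_deriveB dD2 dR2)).
move: lD1 lD2 lR1 lR2; rewrite !derive1E.
have [_ ->] := dD1; have [_ ->] := dD2; have [_ ->] := dR1; have [_ ->] := dR2.
by move=> lD1 lD2 lR1 lR2; exact: four_le.
Qed.

(** By the product rule, a derivative falling on [v^(-1/2)] or on the theta sum costs a factor
    [1 / v] either way. The constant depends on [T] alone, because [gauss_tail T] involves neither
    [x], [y] nor [v]. *)
Lemma dirichlet_kernel_bounds T : 0 < T -> exists2 A : R, 0 < A &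
  forall x y v, 0 <= x <= 1 -> 0 <= y <= 1 -> 0 < v -> v <= T ->
  [/\ derivable (fun r => dirichlet_kernel r x y) v 1,
      `|dirichlet_kernel v x y| <=
        A * v `^ (- 2^-1) * expR (- ((x - y) ^+ 2 / (16 * v))) &
      `|derive1 (fun r => dirichlet_kernel r x y) v| <=
        A * v `^ (- (3 / 2)) * expR (- ((x - y) ^+ 2 / (16 * v)))].
Proof.
move=> T0; set K := \int[counting]_n gauss_tail T n.
have K0 : 0 <= K by apply: Rintegral_ge0 => n _; exact: gauss_tail_ge0.
pose c : R := (4 * pi) `^ (- 2^-1).
have c0 : 0 < c by rewrite powR_gt0 // mulr_gt0// pi_gt0.
(* The 10 is 8 from the derivative of the theta sum plus 2, that is [4 * 2^-1], from the derivative
   of the power; the kernel itself requires 4. Adding 1 makes the constant strictly positive. *)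
exists (10 * (c * K) + 1); first by have : 0 <= c * K; [rewrite mulr_ge0// ltW|lra].
move=> x y v hx hy v0 vT.
have cK0 : 0 <= c * K by rewrite mulr_ge0// ltW.
set e := expR _; have e0 : 0 <= e by exact: expR_ge0.
have [D dD lD] := dirichlet_theta_derive hx hy v0 vT.
have lth := dirichlet_theta_le hx hy v0 vT.
rewrite -/K -/e in lD lth.
set p := v `^ (- 2^-1); have p0 : 0 <= p by exact: powR_ge0.
set q := v `^ (- (3 / 2)).
have qE : q = p / v.
  rewrite /q /p -{3}(powRr1 (ltW v0)) -powRN -powRD; last first.
    by rewrite (gt_eqF v0) implybT.
  by congr (_ `^ _); field.
have q0 : 0 <= q by exact: powR_ge0.
have dp : is_derive v (1 : R) (fun r => r `^ (- 2^-1)) (- 2^-1 * q).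
  have := @is_derive1_powR _ (- 2^-1) _ v0.
  by rewrite (_ : - 2^-1 - 1 = - (3 / 2)) //; field.
have dk : is_derive v (1 : R) (fun r => dirichlet_kernel r x y)
    (c * (p * D + dirichlet_theta x y v * (- 2^-1 * q))).
  apply: (@near_eq_is_derive _ _ _ (fun r => c * (r `^ (- 2^-1) * dirichlet_theta x y r))).
    near=> r; rewrite dirichlet_kernelE ?mulrA//; near: r; exact: lt_nbhsr.
split; first by have [] := dk.
- rewrite dirichlet_kernelE// -/p -/c !normrM (ger0_norm (ltW c0)) (ger0_norm p0).
  have h : c * p * `|dirichlet_theta x y v| <= c * p * (4 * (K * e)).
    by rewrite ler_wpM2l// mulr_ge0// ltW.
  apply: (le_trans h).
  have -> : c * p * (4 * (K * e)) = 4 * (c * K) * (p * e) by ring.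
  by rewrite -[leRHS]mulrA ler_wpM2r ?mulr_ge0//; lra.
- rewrite derive1E; have [_ ->] := dk.
  rewrite normrM (ger0_norm (ltW c0)).
  have h1 : `|p * D| <= 8 * K * (q * e).
    rewrite normrM (ger0_norm p0).
    apply: le_trans (ler_wpM2l p0 lD) _.
    by rewrite qE le_eqVlt; apply/orP; left; apply/eqP; ring.
  have h2 : `|dirichlet_theta x y v * (- 2^-1 * q)| <= 2 * K * (q * e).
    rewrite !normrM normrN (ger0_norm q0) (@gtr0_norm _ 2^-1)//.
    by have := ler_wpM2r q0 lth; lra.
  have h : `|p * D + dirichlet_theta x y v * (- 2^-1 * q)| <= 10 * K * (q * e).
    by apply: le_trans (ler_normD _ _) _; lra.
  apply: le_trans (ler_wpM2l (ltW c0) h) _.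
  have -> : c * (10 * K * (q * e)) = 10 * (c * K) * (q * e) by ring.
  by rewrite -[leRHS]mulrA ler_wpM2r ?mulr_ge0//; lra.
Unshelve. all: by end_near. Qed.
End images.

(** * Integrals with a rescaled power singularity *)

Lemma ler_powRN {R : realType} (p x y : R) : 0 <= p -> 0 < x -> x <= y ->
  y `^ (- p) <= x `^ (- p).
Proof.
move=> p0 x0 xy; have y0 : 0 < y by exact: lt_le_trans xy.
rewrite !powRN lef_pV2 ?posrE ?powR_gt0//.
by rewrite ge0_ler_powR// nnegrE ltW.
Qed.

Lemma powRB1 {R : realType} (x p : R) : 0 < x -> x `^ (p - 1) = x `^ p / x.
Proof. by move=> x0; rewrite powRB ?powRr1 ?ltW// (gt_eqF x0) implybT. Qed.

(** The derivative at [t] is the pointwise limit of difference quotients along a sequence of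
    positive increments, and each quotient is measurable. *)
Lemma measurable_partial1of2 {R : realType} d {Y : measurableType d}
    (f : R -> Y -> R) (B : set Y) (t v : R) : measurable B -> t < v ->
  (forall x, t <= x < v -> measurable_fun B (f x)) ->
  (forall y, B y -> derivable (f ^~ y) t 1) ->
  measurable_fun B (partial1of2 f t).
Proof.
(* The factor [1 / 2] keeps [t + h n] strictly below [v] already for [n = 0], where [harmonic n] is
   1. *)
move=> mB tv mf df; pose h n : R := (v - t) / 2 * harmonic n.
have vt : 0 < v - t by rewrite subr_gt0.
have h0 n : 0 < h n by rewrite !mulr_gt0// ?invr_gt0.
have hv n : h n < v - t.
  apply: (@le_lt_trans _ _ ((v - t) / 2)); last by lra.
  by rewrite ler_piMr ?divr_ge0 ?(ltW vt)// invf_le1// ler1n.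
have hc : h n @[n --> \oo] --> 0.
  by rewrite -[X in _ --> X](mulr0 ((v - t) / 2)); apply: cvgMr; exact: cvg_harmonic.
apply: (@measurable_fun_cvg _ _ _ _ (fun n y => (f (t + h n) y - f t y) / h n)).
- move=> n; apply: measurable_funM => //.
  by apply: measurable_funB; apply: mf; rewrite ?lexx ?tv//; have := hv n; have := h0 n; lra.
- move=> y By; have /cvg_ex[/= l fl] := df y By.
  have -> : partial1of2 f t y = l.
    by apply/cvg_lim => //; move: fl; under eq_fun do rewrite scaler1.
  have hn : (forall n, h n != 0) /\ h n @[n --> \oo] --> 0.
    by split => // n; rewrite gt_eqF.
  move: fl => /cvgr_dnbhsP/(_ _ hn).
  rewrite [X in X @ _ --> _](_ : _ = (fun n => (f (t + h n) y - f t y) / h n))//.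
  by apply/funext => n; rewrite scaler1 [_ + t]addrC [LHS]mulrC.
Qed.

(** * The integrable Beta weight *)

Section beta_weight.
Context {R : realType}.
Notation mu := (@lebesgue_measure R).
Variable al : R.
Hypothesis al01 : 0 < al <= 1.

(** The integrand of the Beta integral [B(al, 1/2)]: the first factor comes from the Volterra
    kernel, the second from the heat kernel. *)
Definition beta_weight (th : R) : R := th `^ (al - 1) * (1 - th) `^ (- 2^-1).

Lemma beta_weight_ge0 th : 0 <= beta_weight th.
Proof. by rewrite mulr_ge0 ?powR_ge0. Qed.

Let half_powRN_le (p x : R) : 0 <= p <= 1 -> 2^-1 <= x -> x `^ (- p) <= 2.
Proof.
move=> /andP[p0 p1] x2; apply: (@le_trans _ _ (2^-1 `^ (- p))).
  by apply: ler_powRN.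
rewrite powRN -(powR_inv1 (ler0n R 2)) -powRrM mulN1r powRN invrK.
by rewrite -[leRHS]powRr1 ?ler_powR ?ler1n.
Qed.

Lemma beta_weight_integrable : mu.-integrable `]0, 1[ (EFin \o beta_weight).
Proof.
move: al01 => /andP[al0 al1].
have i1 := @integrable_powR_left R 0 1 al ltr01 al0.
have i2 := @integrable_powR_right R 0 1 2^-1 ltr01 ltac:(lra).
have m01 : @measurable _ (measurableTypeR R) `]0, 1[ by exact: measurable_itv.
have i3 := integrableZl m01 2 (integrableD m01 i1 i2).
apply: le_integrable i3 => //.
  apply/measurable_EFinP; apply: measurable_funM.
    by apply: measurable_funTS; exact: measurable_powR.
  apply: measurable_funTS; apply: (measurableT_comp (measurable_powR _)).
  exact: measurable_funB.
move=> th /=; rewrite in_itv/= => /andP[th0 th1].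
rewrite lee_fin subr0 (_ : 2^-1 - 1 = - 2^-1 :> R); last by field.
rewrite !ger0_norm ?beta_weight_ge0 ?mulr_ge0 ?addr_ge0 ?powR_ge0//.
rewrite /beta_weight; set a := th `^ _; set b := (1 - th) `^ _.
have a0 : 0 <= a by exact: powR_ge0.
have b0 : 0 <= b by exact: powR_ge0.
(* On each half of the interval one of the two factors is at most 2, so the weight is at most twice
   the sum of the two one-sided powers. *)
have [h|h] := leP 2^-1 th.
  have : a <= 2 by rewrite /a -opprB; apply: half_powRN_le => //; lra.
  by nra.
have : b <= 2 by apply: half_powRN_le; lra.
by nra.
Qed.
End beta_weight.

(** * Bounds on the rescaled integral and its derivative, for an abstract kernel [G] *)

Section singular_convolution.
Context {R : realType}.
Notation mu := (@lebesgue_measure R).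
Variables (al C A m s T : R) (G : R -> R).
Hypothesis al01 : 0 < al <= 2^-1.
Hypotheses (C0 : 0 <= C) (A0 : 0 <= A) (m0 : 0 <= m) (s0 : 0 < s).
Let e v : R := expR (- (m / (16 * v))).
Hypothesis G_derivable : forall v, 0 < v -> v <= T -> derivable G v 1.
Hypothesis G_le : forall v, 0 < v -> v <= T ->
  `|G v| <= A * v `^ (- 2^-1) * e v.
Hypothesis dG_le : forall v, 0 < v -> v <= T ->
  `|derive1 G v| <= A * v `^ (- (3 / 2)) * e v.

(** The integrand of the mixed kernel after [u = s + (r - s) th], Jacobian included, with [G] for
    the heat kernel at fixed [x], [y]. The factor [1 + (r - s) * (th / s)] is [u / s]. *)
Definition rescaled (r th : R) : R :=
  C * th `^ (al - 1) *
  ((r - s) `^ al * (G ((r - s) * (1 - th)) * (1 + (r - s) * (th / s)) `^ al)).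

Let w (r th : R) := 1 + (r - s) * (th / s).

Let drescaled (r th : R) : R :=
  C * th `^ (al - 1) *
  (al * (r - s) `^ (al - 1) * (G ((r - s) * (1 - th)) * w r th `^ al) +
   (r - s) `^ al *
     (derive1 G ((r - s) * (1 - th)) * (1 - th) * w r th `^ al +
      G ((r - s) * (1 - th)) * (th / s * (al * w r th `^ (al - 1))))).

Let arg_bounds (r th : R) : s < r -> r - s <= T -> 0 < th < 1 ->
  0 < (r - s) * (1 - th) /\ (r - s) * (1 - th) <= T.
Proof.
move=> sr rT /andP[th0 th1]; have rs : 0 < r - s by rewrite subr_gt0.
split; first by rewrite mulr_gt0// subr_gt0.
by apply: le_trans rT; rewrite ler_piMr ?(ltW rs)//; lra.
Qed.

Let w_gt0 (r th : R) : s < r -> 0 < th < 1 -> 0 < w r th.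
Proof.
move=> sr /andP[th0 th1]; rewrite /w ltr_wpDr// ltW// mulr_gt0 ?divr_gt0//.
by rewrite subr_gt0.
Qed.

Let w_le (r th : R) : s < r -> 0 < th < 1 -> w r th <= r / s.
Proof.
move=> sr /andP[th0 th1]; rewrite /w ler_pdivlMr// mulrDl mul1r -mulrA divfK ?gt_eqF//.
have : (r - s) * th <= r - s by rewrite ler_piMr; lra.
by lra.
Qed.

Lemma rescaled_derive (r th : R) : s < r -> r - s <= T -> 0 < th < 1 ->
  is_derive r (1 : R) (rescaled ^~ th) (drescaled r th).
Proof.
move=> sr rT hth; have [v0 vT] := arg_bounds sr rT hth.
have w0 := w_gt0 sr hth.
have rs : 0 < r - s by rewrite subr_gt0.
have d1 : is_derive r (1 : R) (fun u => (u - s) `^ al) (al * (r - s) `^ (al - 1)).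
  have := @is_derive_powR_affine _ (- s) 1 al r.
  by under eq_fun do rewrite mul1r addrC; rewrite !mul1r addrC; exact.
have d2 : is_derive r (1 : R) (fun u => G ((u - s) * (1 - th)))
    (derive1 G ((r - s) * (1 - th)) * (1 - th)).
  have dl : is_derive r (1 : R) (fun u : R => (u - s) * (1 - th)) (1 - th).
    by apply: is_derive_eq; rewrite /GRing.scale /=; ring.
  have dG : is_derive ((r - s) * (1 - th)) (1 : R) G
      (derive1 G ((r - s) * (1 - th))).
    by rewrite derive1E; apply: DeriveDef => //; exact: G_derivable.
  exact: (@is_derive1_comp _ G (fun u : R => (u - s) * (1 - th)) _ _ _ dG dl).
have d3 : is_derive r (1 : R) (fun u => w u th `^ al)
    (th / s * (al * w r th `^ (al - 1))).
  have wE u : w u th = (1 - th) + th / s * u.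
    by rewrite /w; field; rewrite gt_eqF.
  have := @is_derive_powR_affine _ (1 - th) (th / s) al r.
  by rewrite -wE => /(_ w0); under eq_fun do rewrite -wE.
have := is_deriveZ (C * th `^ (al - 1)) (is_deriveM d1 (is_deriveM d2 d3)).
move=> h; apply: (is_derive_eq h); rewrite /drescaled /GRing.scale /=.
by rewrite !fctE; ring.
Qed.

(** Up to constants this is the claimed bound: for [al = H - 1/2] the exponent [al - 1/2] is
    [-(1 - H)]. *)
Let K (r : R) : R := C * A * (r - s) `^ (al - 2^-1) * (r / s) `^ al * e (r - s).

Let K_ge0 r : 0 <= K r.
Proof. by rewrite /K !mulr_ge0 ?powR_ge0 ?expR_ge0. Qed.

(** Monotonicity in [v] takes the Gaussian factor out of the integral: [(r - s) * (1 - th)] never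
    exceeds [r - s]. *)
Let e_le (v v' : R) : 0 < v -> v <= v' -> e v <= e v'.
Proof.
move=> v0 vv'; have v'0 : 0 < v' by exact: lt_le_trans vv'.
by rewrite /e ler_expR lerN2 ler_wpM2l// lef_pV2 ?posrE ?mulr_gt0// ler_pM2l.
Qed.

Let Y (r th : R) : R :=
  A * ((r - s) `^ (- 2^-1) * (1 - th) `^ (- 2^-1)) * e (r - s) * (r / s) `^ al.

Let Y_ge0 r th : 0 <= Y r th.
Proof. by rewrite /Y !mulr_ge0 ?powR_ge0 ?expR_ge0. Qed.

Let Gw_le (r th : R) : s < r -> r - s <= T -> 0 < th < 1 ->
  `|G ((r - s) * (1 - th))| * w r th `^ al <= Y r th.
Proof.
move=> sr rT hth; have [v0 vT] := arg_bounds sr rT hth.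
have w0 := w_gt0 sr hth; have wr := w_le sr hth; move: hth => /andP[th0 th1].
have rs : 0 < r - s by rewrite subr_gt0.
have t1 : 0 < 1 - th by rewrite subr_gt0.
move: al01 => /andP[al0 al1].
have hW : w r th `^ al <= (r / s) `^ al.
  by rewrite ge0_ler_powR ?nnegrE ?(ltW al0) ?(ltW w0)// ltW// (lt_le_trans w0).
apply: ler_pM => //; first exact: powR_ge0.
apply: (le_trans (G_le v0 vT)); rewrite powRM ?(ltW rs) ?(ltW t1)//.
apply: ler_wpM2l; first by rewrite !mulr_ge0 ?powR_ge0.
by apply: e_le => //; rewrite ler_piMr ?(ltW rs)//; lra.
Qed.

(** The derivative bound alone would give the non-integrable [(1 - th)^(-3/2)]; the chain-rule
    factor [1 - th] restores the exponent [-1/2]. *)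
Let dGw_le (r th : R) : s < r -> r - s <= T -> 0 < th < 1 ->
  `|derive1 G ((r - s) * (1 - th))| * (1 - th) * w r th `^ al <= Y r th / (r - s).
Proof.
move=> sr rT hth; have [v0 vT] := arg_bounds sr rT hth.
have w0 := w_gt0 sr hth; have wr := w_le sr hth; move: hth => /andP[th0 th1].
have rs : 0 < r - s by rewrite subr_gt0.
have t1 : 0 < 1 - th by rewrite subr_gt0.
move: al01 => /andP[al0 al1].
have hW : w r th `^ al <= (r / s) `^ al.
  by rewrite ge0_ler_powR ?nnegrE ?(ltW al0) ?(ltW w0)// ltW// (lt_le_trans w0).
rewrite /Y [leRHS]mulrAC; apply: ler_pM => //; first by rewrite mulr_ge0// ltW.
  exact: powR_ge0.
have := dG_le v0 vT; rewrite (_ : - (3 / 2) = - 2^-1 - 1); last by field.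
rewrite powRB1// powRM ?(ltW rs) ?(ltW t1)// => h.
rewrite -ler_pdivlMr//; apply: (le_trans h).
have -> : A * ((r - s) `^ (- 2^-1) * (1 - th) `^ (- 2^-1)) * e (r - s) / (r - s) / (1 - th)
   = A * ((r - s) `^ (- 2^-1) * (1 - th) `^ (- 2^-1) / ((r - s) * (1 - th))) * e (r - s).
  by field; rewrite !gt_eqF.
apply: ler_wpM2l.
  by rewrite mulr_ge0 ?divr_ge0 ?mulr_ge0 ?powR_ge0 ?(ltW rs) ?(ltW t1).
by apply: e_le => //; rewrite ler_piMr ?(ltW rs)//; lra.
Qed.

Let KE (r th : R) : s < r -> K r * beta_weight al th =
  C * th `^ (al - 1) * ((r - s) `^ al * Y r th).
Proof.
move=> sr; rewrite /K /Y /beta_weight powRD; last first.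
  by rewrite [r - s == 0]gt_eqF ?implybT ?subr_gt0.
by ring.
Qed.

Lemma rescaled_le (r th : R) : s < r -> r - s <= T -> 0 < th < 1 ->
  `|rescaled r th| <= K r * beta_weight al th.
Proof.
move=> sr rT hth; rewrite KE// /rescaled normrM ger0_norm ?mulr_ge0 ?powR_ge0//.
apply: ler_wpM2l; first by rewrite mulr_ge0 ?powR_ge0.
rewrite normrM ger0_norm ?powR_ge0//; apply: ler_wpM2l; first exact: powR_ge0.
by rewrite normrM (ger0_norm (powR_ge0 _ _)); exact: Gw_le.
Qed.

(** The derivative may fall on the power of [r - s], on [G] or on [w]. Each of the three terms is at
    most the bound for [rescaled] divided by [r - s], whence the 3. *)
Let drescaled_le (r th : R) : s < r -> r - s <= T -> 0 < th < 1 ->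
  `|drescaled r th| <= 3 * (K r / (r - s)) * beta_weight al th.
Proof.
move=> sr rT hth.
have rs : 0 < r - s by rewrite subr_gt0.
have w0 := w_gt0 sr hth.
have hY := Gw_le sr rT hth; have hdY := dGw_le sr rT hth.
move: (al01) (hth) => /andP[al0 al1] /andP[th0 th1].
have -> : 3 * (K r / (r - s)) * beta_weight al th =
    C * th `^ (al - 1) * ((r - s) `^ al * (3 * (Y r th / (r - s)))).
  transitivity (3 / (r - s) * (K r * beta_weight al th)); first by ring.
  by rewrite KE//; ring.
rewrite /drescaled normrM ger0_norm ?mulr_ge0 ?powR_ge0//.
apply: ler_wpM2l; first by rewrite mulr_ge0 ?powR_ge0.
rewrite !powRB1//.
set g := G _ in hY *; set g' := derive1 G _ in hdY *.
set W := w r th `^ al in hY hdY *; have W0 : 0 <= W by exact: powR_ge0.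
set p := (r - s) `^ al; have p0 : 0 <= p by exact: powR_ge0.
have -> : al * (p / (r - s)) * (g * W) +
    p * (g' * (1 - th) * W + g * (th / s * (al * (W / w r th)))) =
    p * (al / (r - s) * (g * W) + g' * (1 - th) * W +
         al * (th / s / w r th) * (g * W)) by ring.
rewrite normrM (ger0_norm p0); apply: ler_wpM2l => //.
have n1 : `|al / (r - s) * (g * W)| <= Y r th / (r - s).
  rewrite normrM (@ger0_norm _ (al / (r - s))) ?divr_ge0 ?(ltW al0) ?(ltW rs)//.
  rewrite normrM (ger0_norm W0) mulrAC ler_pM2r ?invr_gt0//.
  by apply: le_trans hY; rewrite ler_piMl ?mulr_ge0//; lra.
have n2 : `|g' * (1 - th) * W| <= Y r th / (r - s).
  by rewrite !normrM (ger0_norm W0) (@ger0_norm _ (1 - th))//; lra.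
have n3 : `|al * (th / s / w r th) * (g * W)| <= Y r th / (r - s).
  have ths : 0 <= th / s / w r th by rewrite !divr_ge0// ltW.
  (* This holds because [(r - s) * (th / s)] is [w r th - 1]. *)
  have thw : th / s / w r th <= (r - s)^-1.
    by rewrite ler_pdivrMr// [leRHS]mulrC ler_pdivlMr// /w [leLHS]mulrC lerDr.
  rewrite normrM (ger0_norm (mulr_ge0 (ltW al0) ths)).
  rewrite normrM (ger0_norm W0) mulrC.
  have alth : al * (th / s / w r th) <= (r - s)^-1.
    by apply: (le_trans _ thw); rewrite ler_piMl//; lra.
  have alth0 : 0 <= al * (th / s / w r th) by rewrite mulr_ge0// ltW.
  by apply: ler_pM => //; rewrite mulr_ge0.
move: n1 n2 n3; rewrite !ler_norml => /andP[? ?] /andP[? ?] /andP[? ?].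
by apply/andP; split; lra.
Qed.

Let al1 : 0 < al <= 1.
Proof. by move: al01 => /andP[? ?]; apply/andP; split; lra. Qed.

Lemma rescaled_continuous (r : R) : s < r -> r - s <= T ->
  {in `]0, 1[, continuous (rescaled r)}.
Proof.
move=> sr rT th; rewrite in_itv/= => hth.
have [v0 vT] := arg_bounds sr rT hth; have w0 := w_gt0 sr hth.
move: (hth) => /andP[th0 th1].
have d1 := @is_derive1_powR _ (al - 1) _ th0.
have d2 : is_derive th (1 : R) (fun u => G ((r - s) * (1 - u)))
    (derive1 G ((r - s) * (1 - th)) * - (r - s)).
  have dl : is_derive th (1 : R) (fun u : R => (r - s) * (1 - u)) (- (r - s)).
    by apply: is_derive_eq; rewrite /GRing.scale /=; ring.
  have dG : is_derive ((r - s) * (1 - th)) (1 : R) G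
      (derive1 G ((r - s) * (1 - th))).
    by rewrite derive1E; apply: DeriveDef => //; exact: G_derivable.
  exact: (@is_derive1_comp _ G (fun u : R => (r - s) * (1 - u)) _ _ _ dG dl).
have d3 : is_derive th (1 : R) (fun u => w r u `^ al)
    ((r - s) / s * (al * w r th `^ (al - 1))).
  have wE u : w r u = 1 + (r - s) / s * u by rewrite /w; field; rewrite gt_eqF.
  have := @is_derive_powR_affine _ 1 ((r - s) / s) al th.
  by rewrite -wE => /(_ w0); under eq_fun do rewrite -wE.
exact: (is_derive1_continuous (is_deriveM (is_deriveZ C d1)
  (is_deriveZ ((r - s) `^ al) (is_deriveM d2 d3)))).
Qed.

Lemma rescaled_integrable (r : R) : s < r -> r - s <= T ->
  mu.-integrable `]0, 1[ (EFin \o rescaled r).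
Proof.
move=> sr rT.
have m01 : @measurable _ (measurableTypeR R) `]0, 1[ by exact: measurable_itv.
have := integrableZl m01 (K r) (beta_weight_integrable al1).
apply: le_integrable => //.
  apply/measurable_EFinP; apply: open_continuous_measurable_fun => //.
  by apply/in_continuous_mksetP; exact: rescaled_continuous.
move=> th /=; rewrite in_itv/= lee_fin => hth.
by apply: (le_trans (rescaled_le sr rT hth)); exact: ler_norm.
Qed.

Lemma Rintegral_rescaled_le (r : R) : s < r -> r - s <= T ->
  `|\int[mu]_(th in `]0, 1[) rescaled r th| <=
    K r * \int[mu]_(th in `]0, 1[) beta_weight al th.
Proof.
move=> sr rT.
have m01 : @measurable _ (measurableTypeR R) `]0, 1[ by exact: measurable_itv.
have i := rescaled_integrable sr rT.
apply: (le_trans (le_normr_Rintegral m01 i)).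
rewrite -RintegralZl//; last exact: beta_weight_integrable.
apply: le_Rintegral => //; first exact: integrable_norm.
  exact: (integrableZl m01 (K r) (beta_weight_integrable al1)).
by move=> th /=; rewrite in_itv/= => hth; exact: rescaled_le.
Qed.

(** Differentiation under the integral needs a majorant on a window around [t]. The window reaches
    up to [r - s = 2 * (t - s)], which is why [T] must dominate that quantity. *)
Lemma Rintegral_rescaled_derive (t : R) : s < t -> 2 * (t - s) <= T ->
  derivable (fun r => \int[mu]_(th in `]0, 1[) rescaled r th) t 1 /\
  `|derive1 (fun r => \int[mu]_(th in `]0, 1[) rescaled r th) t| <=
    3 * (K t / (t - s)) * \int[mu]_(th in `]0, 1[) beta_weight al th.
Proof.
move=> st tT; move: (al01) => /andP[al0 al2].
have ts : 0 < t - s by rewrite subr_gt0.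
have m01 : @measurable _ (measurableTypeR R) `]0, 1[ by exact: measurable_itv.
pose u := s + (t - s) / 2; pose v := s + 2 * (t - s).
have It : `]u, v[%classic t.
  by rewrite /= in_itv/= /u /v; apply/andP; split; lra.
have I_gt r : `]u, v[%classic r -> s < r /\ r - s <= T.
  by rewrite /= in_itv/= /u /v => /andP[? ?]; split; lra.
have i r : `]u, v[%classic r -> mu.-integrable `]0, 1[ (EFin \o rescaled r).
  by move=> /I_gt[? ?]; exact: rescaled_integrable.
have d (r th : R) : `]u, v[%classic r -> `]0, 1[%classic th ->
    derivable (rescaled ^~ th) r 1.
  move=> /I_gt[sr rT]; rewrite /= in_itv/= => hth.
  by have [] := rescaled_derive sr rT hth.
have dE (r th : R) : `]u, v[%classic r -> `]0, 1[%classic th ->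
    partial1of2 rescaled r th = drescaled r th.
  move=> /I_gt[sr rT]; rewrite /= in_itv/= => hth.
  by rewrite partial1of2E; have [_ ->] := rescaled_derive sr rT hth.
(* [K r / (r - s)] is maximised factor by factor over the window: the nonpositive power and the
   reciprocal at [r - s = (t - s) / 2], the ratio [r / s] at [v], the exponential by 1. *)
pose M := 3 * (C * A * ((t - s) / 2) `^ (al - 2^-1) * (v / s) `^ al / ((t - s) / 2)).
have M0 : 0 <= M.
  rewrite /M mulr_ge0// divr_ge0 ?mulr_ge0 ?powR_ge0// ltW//.
have G0 th : 0 <= M * beta_weight al th by rewrite mulr_ge0 ?beta_weight_ge0.
have Gi : mu.-integrable `]0, 1[ (EFin \o (fun th => M * beta_weight al th)).
  exact: (integrableZl m01 M (beta_weight_integrable al1)).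
have Gub (r th : R) : `]u, v[%classic r -> `]0, 1[%classic th ->
    `|partial1of2 rescaled r th| <= M * beta_weight al th.
  move=> Ir Ith; rewrite dE//; move: Ir Ith => Ir.
  have [sr rT] := I_gt _ Ir; rewrite /= in_itv/= => hth.
  apply: (le_trans (drescaled_le sr rT hth)).
  rewrite ler_wpM2r ?beta_weight_ge0// /M ler_pM2l// /K.
  move: Ir; rewrite /= in_itv/= => /andP[ur rv].
  have h2 : (t - s) / 2 <= r - s by move: ur; rewrite /u; lra.
  have h20 : 0 < (t - s) / 2 by rewrite divr_gt0.
  have e1 : e (r - s) <= 1.
    rewrite expR_le1 oppr_le0 divr_ge0// mulr_ge0// ltW//; lra.
  apply: ler_pM.
  - by rewrite !mulr_ge0 ?powR_ge0 ?expR_ge0.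
  - by rewrite invr_ge0; lra.
  - apply: (@le_trans _ _ (C * A * (r - s) `^ (al - 2^-1) * (r / s) `^ al)).
      by rewrite ler_piMr ?mulr_ge0 ?powR_ge0.
    apply: ler_pM; rewrite ?mulr_ge0 ?powR_ge0//.
      apply: ler_wpM2l; first by rewrite mulr_ge0.
      rewrite -[al - 2^-1]opprB; apply: ler_powRN => //.
      by rewrite subr_ge0.
    rewrite ge0_ler_powR ?nnegrE ?(ltW al0)// ?(divr_ge0 _ (ltW s0))//.
    + exact: ltW (lt_trans s0 sr).
    + exact: ltW (lt_trans s0 (lt_trans sr rv)).
    + by rewrite ler_pM2r ?invr_gt0// ltW.
  - by rewrite lef_pV2 ?posrE ?subr_gt0.
split; first exact: (derivable_under_integral m01 It i d G0 Gi Gub).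
rewrite (differentiation_under_integral m01 It i d G0 Gi Gub).
(* Once derivative and integral are interchanged, the estimate at [r = t] itself recovers the
   Gaussian factor that [M] discards. *)
have hd (th : R) : `]0, 1[%classic th ->
    `|partial1of2 rescaled t th| <= 3 * (K t / (t - s)) * beta_weight al th.
  move=> Ith; rewrite dE//; move: Ith; rewrite /= in_itv/= => hth.
  by have [st' tT'] := I_gt _ It; exact: drescaled_le.
have mp : measurable_fun (`]0, 1[%classic : set R) (partial1of2 rescaled t).
  apply: (@measurable_partial1of2 _ _ _ _ _ _ v) => //.
  - by rewrite /v; lra.
  - move=> x /andP[tx xv]; apply/measurable_EFinP.
    have /i : `]u, v[%classic x by rewrite /= in_itv/= xv andbT; move: tx; rewrite /u; lra.
    exact: measurable_int.
  - by move=> th; exact: d.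
have ip : mu.-integrable `]0, 1[ (EFin \o partial1of2 rescaled t).
  apply: le_integrable Gi => //; first exact/measurable_EFinP.
  move=> th Ith /=; rewrite lee_fin (le_trans (Gub _ _ It Ith))//; exact: ler_norm.
apply: (le_trans (le_normr_Rintegral m01 ip)).
rewrite -RintegralZl//; last exact: beta_weight_integrable.
apply: le_Rintegral => //; first exact: integrable_norm.
exact: (integrableZl m01 (3 * (K t / (t - s))) (beta_weight_integrable al1)).
Qed.

End singular_convolution.

(** * The Volterra kernel *)

Section volterra_kernel.
Context {R : realType}.
Notation mu := (@lebesgue_measure R).
Implicit Types H C s t u v r x y : R.

(** The fundamental theorem applied to the upper limit of integration; the prefactor [s^(1/2 - H)]
    merges with [v^(H - 1/2)] into a power of [v / s]. *)
Lemma KH_derive H C s v : 2^-1 < H < 1 -> 0 < s -> s < v ->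
  is_derive v (1 : R) (fun w => KH H C w s)
    (C * (v / s) `^ (H - 2^-1) * (v - s) `^ (H - 2^-1 - 1)).
Proof.
move=> /andP[H0 H1] s0 sv; have v0 : 0 < v by exact: lt_trans sv.
have vs : 0 < v - s by rewrite subr_gt0.
pose f u := (u - s) `^ (H - 3 / 2) * u `^ (H - 2^-1).
have He : H - 3 / 2 = H - 2^-1 - 1 by field.
have mf D : measurable_fun D f.
  apply: measurable_funTS; apply: measurable_funM; last exact: measurable_powR.
  by apply: (measurableT_comp (measurable_powR _)); exact: measurable_funB.
(* The theorem is applied up to [v + 1]; the open interval ending at [v + 2] contains []s, v + 1]]
   and fits the criterion for powers singular at the left end. *)
have fi : mu.-integrable `]s, (v + 2)[ (EFin \o f).
  have sv2 : s < v + 2 by lra.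
  have H20 : 0 < H - 2^-1 by lra.
  have m : @measurable _ (measurableTypeR R) `]s, (v + 2)[ by exact: measurable_itv.
  have := integrableZl m ((v + 2) `^ (H - 2^-1)) (integrable_powR_left sv2 H20).
  apply: le_integrable => //; first by apply/measurable_EFinP; exact: mf.
  move=> u /=; rewrite in_itv/= => /andP[su uv].
  rewrite lee_fin !ger0_norm ?mulr_ge0 ?powR_ge0// /f He mulrC ler_wpM2r ?powR_ge0//.
  by rewrite ge0_ler_powR ?nnegrE//; move: (u : R) su uv => u' su uv; lra.
have fi1 : mu.-integrable `]s, (v + 1)] (EFin \o f).
  apply: integrableS fi => //= u /=; rewrite !in_itv/= => /andP[-> h] /=; lra.
have cf : {for v, continuous f}.
  have d1 := @is_derive_powR_affine _ (- s) 1 (H - 3 / 2) v.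
  have {}d1 : is_derive v (1 : R) (fun u => (u - s) `^ (H - 3 / 2))
      ((H - 3 / 2) * (v - s) `^ (H - 3 / 2 - 1)).
    move: d1; under eq_fun do rewrite mul1r addrC.
    by rewrite !mul1r addrC; exact.
  exact: (is_derive1_continuous (is_deriveM d1 (@is_derive1_powR _ (H - 2^-1) _ v0))).
have vv1 : v < v + 1 by rewrite ltrDl.
have sv' : (BRight s < BRight v)%O by rewrite bnd_simp.
have [dF FE] := continuous_FTC1 vv1 fi1 sv' cf.
have isF : is_derive v (1 : R) (fun w => \int[mu]_(u in `]s, w]) f u) (f v).
  by apply: DeriveDef => //; rewrite -derive1E.
have -> : C * (v / s) `^ (H - 2^-1) * (v - s) `^ (H - 2^-1 - 1) =
    C * s `^ (2^-1 - H) *: f v.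
  rewrite /f He -[2^-1 - H]opprB powRN powRM ?invr_ge0 ?ltW//.
  rewrite -(powR_inv1 (ltW s0)) -powRrM mulN1r powRN /GRing.scale /=; ring.
have -> : (fun w => KH H C w s) =
    (C * s `^ (2^-1 - H)) \*: (fun w => \int[mu]_(u in `]s, w]) f u).
  (* [KH] integrates over []s, w[] and the fundamental theorem over []s, w]]; the extra point has
     measure zero. *)
  apply/funext => w; rewrite /KH /Rintegral integral_itv_bndo_bndc//; exact/measurable_EFinP.
exact: is_deriveZ.
Qed.

Lemma M_integrandE H C r s x y u : 2^-1 < H < 1 -> 0 < s -> s < u ->
  M_integrand H C r s x y u = dirichlet_kernel (r - u) x y *
    (C * (u / s) `^ (H - 2^-1) * (u - s) `^ (H - 2^-1 - 1)).
Proof.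
move=> hH s0 su; rewrite /M_integrand derive1E.
by have [_ ->] := @KH_derive H C s u hH s0 su.
Qed.

Lemma M_integrand_affine H C r s x y th :
  2^-1 < H < 1 -> 0 < s -> s < r -> 0 < th < 1 ->
  M_integrand H C r s x y (s + (r - s) * th) =
  (r - s)^-1 * rescaled (H - 2^-1) C s (fun v => dirichlet_kernel v x y) r th.
Proof.
move=> hH s0 sr /andP[th0 th1]; have rs : 0 < r - s by rewrite subr_gt0.
have su : s < s + (r - s) * th by rewrite ltrDl mulr_gt0.
rewrite M_integrandE// /rescaled.
have -> : r - (s + (r - s) * th) = (r - s) * (1 - th) by ring.
have -> : (s + (r - s) * th) / s = 1 + (r - s) * (th / s) by field; rewrite gt_eqF.
have -> : s + (r - s) * th - s = (r - s) * th by ring.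
by rewrite powRM ?ltW// [(r - s) `^ (_ - 1)]powRB1//; ring.
Qed.

Lemma M_kernel_rescaled H C r s x y : 2^-1 < H < 1 -> 0 < s -> s < r ->
  let F := rescaled (H - 2^-1) C s (fun v => dirichlet_kernel v x y) r in
  mu.-integrable `]0, 1[ (EFin \o F) ->
  mu.-integrable `]s, r[ (EFin \o M_integrand H C r s x y) /\
  M_kernel H C r s x y = \int[mu]_(th in `]0, 1[) F th.
Proof.
move=> hH s0 sr F Fi; have rs : 0 < r - s by rewrite subr_gt0.
pose phi th := s + (r - s) * th.
have pre : phi @^-1` `]s, r[ = `]0, 1[%classic.
  by rewrite preimage_affine_itv// subrr mul0r divff// gt_eqF.
have m01 : @measurable _ (measurableTypeR R) `]0, 1[ by exact: measurable_itv.
have ME th : `]0, 1[%classic th -> M_integrand H C r s x y (phi th) = (r - s)^-1 * F th.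
  by rewrite /= in_itv/= => hth; exact: M_integrand_affine.
have Mi : mu.-integrable (phi @^-1` `]s, r[) (EFin \o (M_integrand H C r s x y \o phi)).
  rewrite pre; apply: eq_integrable (integrableZl m01 (r - s)^-1 Fi) => //.
  by move=> th /set_mem hth /=; rewrite -EFinM ME.
(* [M_integrand] contains a derivative, so its measurability is deduced from that of its pullback,
   composed with the inverse affine map. *)
have mM : measurable_fun `]s, r[ (M_integrand H C r s x y).
  apply: (@eq_measurable_fun _ _ _ _ _
    ((M_integrand H C r s x y \o phi) \o (fun u => (u - s) / (r - s)))).
    by move=> u _ /=; congr (M_integrand _ _ _ _ _ _ _); rewrite /phi; field; rewrite gt_eqF.
  refine (@measurable_comp _ _ _ R R R `]0, 1[%classic (M_integrand H C r s x y \o phi)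
    `]s, r[%classic (fun u => (u - s) / (r - s)) _ _ _ _) => //.
  - move=> _ [u /= + <-]; rewrite !in_itv/= => /andP[su ur].
    by rewrite divr_gt0 ?subr_gt0//= ltr_pdivrMr// mul1r ltrD2r.
  - by rewrite -pre; apply/measurable_EFinP; exact: measurable_int Mi.
  - apply: measurable_funTS; apply: measurable_funM => //.
    exact: measurable_funB.
split; first exact: integrable_affine Mi.
rewrite /M_kernel (@Rintegral_affine _ s _ rs _ _ _ mM Mi)// -/phi pre.
rewrite -RintegralZl//; last by rewrite -pre.
apply: eq_Rintegral => th /set_mem hth /=.
by rewrite [X in _ * X]ME// mulrA divff ?mul1r// gt_eqF.
Qed.

End volterra_kernel.

(** * The bounds on the mixed kernel and its time derivative *)

Unset Implicit Arguments.

Theorem proposition3p5 (R : realType) (T H CH : R)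
    (hT : 0 < T) (hH : 2^-1 < H < 1) (hCH : is_KH_const H CH) :
  exists c5 c6 c7 c8 : R,
    [/\ 0 < c5, 0 < c6, 0 < c7 & 0 < c8] /\
    forall s t x y : R, 0 < s -> s < t -> t <= T ->
      0 <= x <= 1 -> 0 <= y <= 1 ->
      [/\ (@lebesgue_measure R).-integrable `]s, t[
            (fun u => (M_integrand H CH t s x y u)%:E),
          M_kernel H CH t s x y <=
            c5 * (t - s) `^ (- (1 - H)) * (t / s) `^ (H - 2^-1) *
            (expR (- (c6 * (x - y) ^+ 2 / (t - s))) +
             expR (- (c6 * (x + y - 2) ^+ 2 / (t - s)))),
          derivable (fun r : R => M_kernel H CH r s x y) t 1 &
          `|derive1 (fun r : R => M_kernel H CH r s x y) t| <=
            c7 * (t - s) `^ (- (2 - H)) * (t / s) `^ (H - 2^-1) *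
            (expR (- (c8 * (x - y) ^+ 2 / (t - s))) +
             expR (- (c8 * (x + y - 2) ^+ 2 / (t - s))))].
Proof.
(* Heat-kernel bounds are needed up to time [2 * T]: differentiating at [t], possibly equal to [T],
   involves [r - s] up to [2 * (t - s)]. *)
have T2 : 0 < 2 * T by rewrite mulr_gt0.
have CH0 : 0 < CH by case: hCH.
have /andP[H0 H1] := hH.
have [A A0 DA] := dirichlet_kernel_bounds T2.
pose al := H - 2^-1.
have al01 : 0 < al <= 2^-1 by rewrite /al; apply/andP; split; lra.
pose B := \int[@lebesgue_measure R]_(th in `]0, 1[) beta_weight al th.
have B0 : 0 <= B by apply: Rintegral_ge0 => th _; exact: beta_weight_ge0.
have CAB0 : 0 <= CH * A * B by rewrite !mulr_ge0 ?(ltW CH0) ?(ltW A0).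
(* The 16 is the one in the heat-kernel exponent and the 3 counts the product-rule terms. Adding 1
   gives strict positivity, as [B] is only known to be nonnegative. *)
exists (CH * A * B + 1), 16^-1, (3 * (CH * A * B) + 1), 16^-1.
split; first by split; lra.
move=> s t x y s0 st tT hx hy.
have ts : 0 < t - s by rewrite subr_gt0.
pose G v := dirichlet_kernel v x y.
have dG v : 0 < v -> v <= 2 * T -> derivable G v 1.
  by move=> v0 vT; have [] := DA x y v hx hy v0 vT.
have lG v : 0 < v -> v <= 2 * T ->
    `|G v| <= A * v `^ (- 2^-1) * expR (- ((x - y) ^+ 2 / (16 * v))).
  by move=> v0 vT; have [] := DA x y v hx hy v0 vT.
have ldG v : 0 < v -> v <= 2 * T ->
    `|derive1 G v| <= A * v `^ (- (3 / 2)) * expR (- ((x - y) ^+ 2 / (16 * v))).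
  by move=> v0 vT; have [] := DA x y v hx hy v0 vT.
have m0 : 0 <= (x - y) ^+ 2 by exact: sqr_ge0.
have tsT : t - s <= 2 * T by lra.
have ts2T : 2 * (t - s) <= 2 * T by lra.
have Fi r : s < r -> r - s <= 2 * T ->
    (@lebesgue_measure R).-integrable `]0, 1[ (EFin \o rescaled al CH s G r).
  move=> sr rT.
  exact: (rescaled_integrable al01 (ltW CH0) (ltW A0) m0 s0 dG lG sr rT).
have ME r : s < r -> r - s <= 2 * T ->
    M_kernel H CH r s x y = \int[@lebesgue_measure R]_(th in `]0, 1[) rescaled al CH s G r th.
  by move=> sr rT; have [] := M_kernel_rescaled hH s0 sr (Fi r sr rT).
have Fle := Rintegral_rescaled_le al01 (ltW CH0) (ltW A0) m0 s0 dG lG st tsT.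
have [dF dFle] :=
  Rintegral_rescaled_derive al01 (ltW CH0) (ltW A0) m0 s0 dG lG ldG st ts2T.
(* The rescaled form is valid on a whole neighbourhood of [t], so differentiability and the
   derivative transfer to [M_kernel]. *)
have nME : \forall r \near t, \int[@lebesgue_measure R]_(th in `]0, 1[) rescaled al CH s G r th =
    M_kernel H CH r s x y.
  near=> r; rewrite ME//.
    by near: r; exact: lt_nbhsr.
  rewrite lerBlDr ltW//; near: r; apply: lt_nbhsl; lra.
have -> : expR (- (16^-1 * (x - y) ^+ 2 / (t - s))) =
    expR (- ((x - y) ^+ 2 / (16 * (t - s)))).
  by congr expR; field; rewrite gt_eqF.
set e := expR (- ((x - y) ^+ 2 / _)) in Fle dFle *.
set e' := expR _; have e0 : 0 <= e by exact: expR_ge0.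
have e'0 : 0 <= e' by exact: expR_ge0.
set W := (t / s) `^ (H - 2^-1).
have W0 : 0 <= W by exact: powR_ge0.
have alE : al - 2^-1 = - (1 - H) by rewrite /al; field.
have pE : (t - s) `^ (- (2 - H)) = (t - s) `^ (- (1 - H)) / (t - s).
  by rewrite -powRB1//; congr (_ `^ _); field.
rewrite alE -/B -/W in Fle dFle.
set p := (t - s) `^ (- (1 - H)) in Fle dFle pE *.
have p0 : 0 <= p by exact: powR_ge0.
set q := (t - s) `^ (- (2 - H)) in pE *.
have q0 : 0 <= q by exact: powR_ge0.
split.
- by have [] := M_kernel_rescaled hH s0 st (Fi t st tsT).
(* The bound with [e] alone is already proved; the second exponential [e'] and the added 1
   contribute nonnegative terms. *)
- rewrite ME//; apply: (le_trans (ler_norm _)); apply: (le_trans Fle).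
  have -> : CH * A * p * W * e * B = CH * A * B * (p * W * e) by ring.
  have -> : (CH * A * B + 1) * p * W * (e + e') =
    CH * A * B * (p * W * e) + CH * A * B * (p * W * e') + p * W * (e + e') by ring.
  have h1 : 0 <= p * W * e' by rewrite !mulr_ge0.
  have h2 : 0 <= p * W * (e + e') by rewrite !mulr_ge0 ?addr_ge0.
  by rewrite -[leRHS]addrA lerDl addr_ge0// mulr_ge0// ?(mulr_ge0 _ CAB0).
- exact: near_eq_derivable nME dF.
- rewrite derive1E -(near_eq_derive _ nME) -derive1E; apply: (le_trans dFle).
  have -> : 3 * (CH * A * p * W * e / (t - s)) * B =
    3 * (CH * A * B) * (q * W * e) by rewrite pE; ring.
  have -> : (3 * (CH * A * B) + 1) * q * W * (e + e') =
    3 * (CH * A * B) * (q * W * e) + 3 * (CH * A * B) * (q * W * e') +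
    q * W * (e + e') by ring.
  have h1 : 0 <= q * W * e' by rewrite !mulr_ge0.
  have h2 : 0 <= q * W * (e + e') by rewrite !mulr_ge0 ?addr_ge0.
  by rewrite -[leRHS]addrA lerDl addr_ge0// mulr_ge0// ?(mulr_ge0 _ CAB0).
Unshelve. all: by end_near. Qed.
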